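(* Let $X=X_-\sqcup X_+$ be a measurable splitting of a Polish space equipped with a Borel probability measure $m$ for which both $X_-$ and $X_+$ have positive measure. Let $\tau_1^\pm,\tau_2^\pm:X_\pm\to X_\pm$ be nonsingular measurable maps and let $p_1=p_2=\frac12$. For $i=1,2$ define $f_i:X\to X$ by $f_i=\tau_i^-$ on $X_-$ and $f_i=\tau_i^+$ on $X_+$. Assume that the random dynamics generated by $\tau_1^+,\tau_2^+$ on $X_+$ (with equal probabilities) satisfies (S), and that the random dynamics generated by $\tau_1^-,\tau_2^-$ on $X_-$ (with equal probabilities) does not satisfy (S). Then $\mathcal L_f=\frac12\mathcal L_{f_1}+\frac12\mathcal L_{f_2}$ satisfies (S), but does not satisfy (WAP).
   Context: A map is nonsingular if preimages of null sets are null ($X_\pm$ carry the normalized restrictions of $m$). The Perron--Frobenius operator $\mathcal L_g$ of a nonsingular map $g$ of $(X,m)$ is defined by $\int_A\mathcal L_g\varphi\,dm=\int_{g^{-1}(A)}\varphi\,dm$ for all $\varphi\in L^1(m)$ and measurable $A$. The annealed Perron--Frobenius operator of two maps $g_1,g_2$ with equal probabilities is $\frac12\mathcal L_{g_1}+\frac12\mathcal L_{g_2}$. Random dynamics satisfies a property if its annealed Perron--Frobenius operator does. (S), for a Markov operator $P$ on $L^1(m)$: $P$ has an invariant density, i.e. there is $h\ge0$ with $\int h\,dm=1$ and $Ph=h$. (WAP) (weakly almost periodic): for any $\varphi\in L^1(m)$ the sequence $(P^n\varphi)_{n\ge1}$ is weakly precompact in $L^1(m)$. *)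

(* Defs.v *)
From HB Require Import structures.
From mathcomp Require Import all_boot all_order all_algebra.
From mathcomp Require Import all_classical all_reals all_analysis.

Set Implicit Arguments.
Unset Strict Implicit.
Unset Printing Implicit Defensive.

Import Order.TTheory GRing.Theory Num.Theory.
Import numFieldNormedType.Exports.

Local Open Scope classical_set_scope.
Local Open Scope ring_scope.

Definition complete_metric_for (R : realType) (X : topologicalType)
    (dist : X -> X -> R) : Prop :=
  [/\ forall x y, dist x y = 0 <-> x = y,
      forall x y, dist x y = dist y x,
      forall x y z, dist x z <= dist x y + dist y z,
      forall (x : X) (U : set X),
        nbhs x U <-> exists2 e, 0 < e & [set y | dist x y < e] `<=` U &
      forall u : nat -> X,
        (forall e, 0 < e -> exists N, forall p q,
           (N <= p)%N -> (N <= q)%N -> dist (u p) (u q) < e) ->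
        exists l : X, u n @[n --> \oo] --> l].

Definition polish_space (R : realType) (X : topologicalType) : Prop :=
  (exists2 D : set X, countable D & dense D) /\
  exists dist : X -> X -> R, complete_metric_for dist.

Notation borel X := (g_sigma_algebraType (@open X)).

(* Elements of [L1 mu] are integrable functions, not classes: equalities and
   inequalities between them are to be read mu-almost everywhere. *)
Notation L1 mu := (LfunType mu (@lexx _ _ 1%E)).

Section transfer_operators.
Context d (T : measurableType d) (R : realType) (mu : probability T R).

Definition nonsingular (g : T -> T) : Prop :=
  measurable_fun setT g /\
  forall A, measurable A -> mu A = 0 -> mu (g @^-1` A) = 0.

Definition is_transfer (g : T -> T) (phi psi : L1 mu) : Prop :=
  forall A, measurable A ->
    (\int[mu]_(x in A) (psi x)%:E = \int[mu]_(x in g @^-1` A) (phi x)%:E)%E.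

(* The a.e. class of the value is determined by [is_transfer] when [g] is
   nonsingular, see [perron_frobeniusP] and [is_transfer_unique]; for other
   maps the default 0 may be taken. *)
Definition perron_frobenius (g : T -> T) (phi : L1 mu) : L1 mu :=
  xget 0 [set psi | is_transfer g phi psi].

Definition annealed_pf (g1 g2 : T -> T) (phi : L1 mu) : L1 mu :=
  2^-1 *: perron_frobenius g1 phi + 2^-1 *: perron_frobenius g2 phi.

Definition has_invariant_density (P : L1 mu -> L1 mu) : Prop :=
  exists h : L1 mu, [/\ {ae mu, forall x, 0 <= h x},
    (\int[mu]_x (h x)%:E = 1)%E & ae_eq mu setT (P h) h].

Definition bounded_functional : set {linear L1 mu -> R^o} :=
  [set l | exists C : R, forall f : L1 mu,
     (`|l f|%:E <= C%:E * 'N[mu]_1[EFin \o f])%E].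

(* The weak topology: the initial topology for the evaluations at all bounded
   linear functionals.  Functions that agree a.e. are topologically
   indistinguishable, so precompactness here (inclusion in a closed compact
   set) is precompactness of the set of a.e. classes. *)
Definition dual_eval (f : L1 mu) : {ptws bounded_functional -> R^o} :=
  fun l => val l f.

Definition weakL1 := initial_topology dual_eval.

Definition weakly_almost_periodic (P : L1 mu -> L1 mu) : Prop :=
  forall phi : L1 mu,
    precompact ([set iter n P phi | n in [set n | (1 <= n)%N]] : set weakL1).

End transfer_operators.

Arguments perron_frobenius {d T R} mu g phi.
Arguments annealed_pf {d T R} mu g1 g2 phi.
Arguments bounded_functional {d T R} mu _.

Section transfer_facts.
Context d (T : measurableType d) (R : realType) (mu : probability T R).

Lemma perron_frobeniusP (g : T -> T) (phi : L1 mu) : nonsingular mu g ->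
  is_transfer g phi (perron_frobenius mu g phi).
Proof.
move=> [mg ns].
suff [psi psiP] : exists psi : L1 mu, is_transfer g phi psi.
  rewrite /perron_frobenius; case: xgetP => [? _ //|/(_ psi)].
  by move=> /(_ psiP).
have intf : mu.-integrable setT (EFin \o phi).
  by apply/Lfun1_integrable; exact: LfunP.
pose nu := pushforward (induced_charge intf) g.
have [nu' nu'E] : exists nu' : {charge set T -> \bar R}, nu' = nu :> (_ -> _).
  by unshelve eexists (pushforward (induced_charge intf) g); first exact: mg.
have nudom : nu' `<< mu.
  apply/null_content_dominatesP => A mA muA; rewrite nu'E.
  have mgA : measurable (g @^-1` A) by rewrite -[X in measurable X]setTI; exact: mg.
  rewrite /nu /pushforward /induced_charge; apply: null_set_integral => //.
  - by have /integrableP[mphi _] := intf; exact: measurable_funS measurableT _ mphi.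
  - exact: ns.
pose psi := fine \o Radon_Nikodym nu' mu.
have psiE : EFin \o psi = Radon_Nikodym nu' mu.
  by apply/funext => x /=; rewrite fineK// Radon_Nikodym_fin_num.
have Lpsi : psi \in Lfun mu 1.
  by apply/Lfun1_integrable; rewrite psiE; exact: Radon_Nikodym_integrable.
exists (Lfun_Sub (lexx 1%E) Lpsi) => A mA /=.
transitivity (\int[mu]_(x in A) Radon_Nikodym nu' mu x)%E.
  by rewrite -psiE.
by rewrite -Radon_Nikodym_integral// nu'E.
Qed.

Lemma is_transfer_unique (g : T -> T) (phi psi1 psi2 : L1 mu) :
  is_transfer g phi psi1 -> is_transfer g phi psi2 ->
  ae_eq mu setT psi1 psi2.
Proof.
move=> h1 h2.
have I (f : L1 mu) : mu.-integrable setT (EFin \o f).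
  by apply/Lfun1_integrable; exact: LfunP.
have : ae_eq mu setT (EFin \o psi1) (EFin \o psi2).
  apply: integral_ae_eq => //; first by have /integrableP[] := I psi2.
  by move=> E _ mE /=; rewrite h1// h2.
by apply: filterS => x /= /(_ Logic.I) [].
Qed.

End transfer_facts.


Section positive_part.
Context d (T : measurableType d) (R : realType) (m : probability T R).

Lemma gt0_measure_nonempty (D : set T) : (0 < m D)%E -> D !=set0.
Proof.
move=> D0; apply/set0P/eqP => DE.
by move: D0; rewrite DE measure0 ltxx.
Qed.

(* The proofs are arguments because measurable types are pointed and because
   [part_measure] is a probability only for measurable D of positive measure. *)
Definition part_carrier (D : set T) (mD : measurable D) (D0 : (0 < m D)%E) :
  Type := set_type D.

Variables (D : set T) (mD : measurable D) (D0 : (0 < m D)%E).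

Definition part_point : part_carrier mD D0 :=
  let: exist x Dx := cid (gt0_measure_nonempty D0) in
  exist _ x (mem_set Dx).

HB.instance Definition _ := gen_eqMixin (part_carrier mD D0).
HB.instance Definition _ := gen_choiceMixin (part_carrier mD D0).
HB.instance Definition _ := isPointed.Build (part_carrier mD D0) part_point.

(* The subset D as a space of its own, with the trace sigma-algebra. *)
Definition part :=
  g_sigma_algebra_preimageType (fun x : part_carrier mD D0 => sval x).

Definition part_incl (x : part) : T := sval x.

Lemma part_incl_inj : injective part_incl.
Proof. exact: val_inj. Qed.

Lemma part_inclP (x : part) : D (part_incl x).
Proof. by case: x => x Dx; exact: set_mem Dx. Qed.

Lemma measurable_part_incl : measurable_fun setT part_incl.
Proof. by move=> _ B mB; exists B. Qed.

Lemma image_part_incl (B : set T) : part_incl @` (part_incl @^-1` B) = D `&` B.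
Proof.
apply/seteqP; split=> [_ [x Bx <-]|x [Dx Bx]].
  by split=> //; exact: part_inclP.
by exists (exist _ x (mem_set Dx)).
Qed.

Lemma measurable_image_part (B : set part) :
  measurable B -> measurable (part_incl @` B).
Proof.
by move=> [C mC <-]; rewrite setTI image_part_incl; exact: measurableI.
Qed.

Definition part_measure (B : set part) : \bar R :=
  (m (part_incl @` B) * (fine (m D))^-1%:E)%E.

Let part_measure0 : part_measure set0 = 0%E.
Proof. by rewrite /part_measure image_set0 measure0 mul0e. Qed.

Let part_measure_ge0 B : (0 <= part_measure B)%E.
Proof. by rewrite mule_ge0// lee_fin invr_ge0 fine_ge0. Qed.

Let part_measure_sigma_additive : semi_sigma_additive part_measure.
Proof.
move=> F mF tF mUF; rewrite /part_measure.
rewrite [X in X @ _ --> _](_ : _ = (fun n =>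
    \sum_(0 <= i < n) m (part_incl @` F i))%E \* cst (fine (m D))^-1%:E)%E; last first.
  by apply/funext => n; rewrite -ge0_sume_distrl.
apply: cvgeZr => //; rewrite image_bigcup.
apply: measure_semi_sigma_additive.
- by move=> i; exact: measurable_image_part.
- apply/trivIsetP => i j _ _ ij; apply/seteqP; split=> [_ [[x Fx <-] [y Fy]]|//].
  move=> /part_incl_inj yx; move: Fy; rewrite yx => Fy.
  have /trivIsetP/(_ i j Logic.I Logic.I ij) E := tF.
  by have : (F i `&` F j) x by []; rewrite E.
- by apply: bigcup_measurable => i _; exact: measurable_image_part.
Qed.

HB.instance Definition _ := isMeasure.Build _ _ _ part_measure
  part_measure0 part_measure_ge0 part_measure_sigma_additive.

Let part_measureT : part_measure setT = 1%E.
Proof.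
rewrite /part_measure -(preimage_setT part_incl) image_part_incl setIT.
have mDfin : m D \is a fin_num by exact: fin_num_measure.
rewrite -{1}(fineK mDfin) -EFinM divff// gt_eqF//.
by rewrite fine_gt0// D0 ltey_eq mDfin.
Qed.

HB.instance Definition _ :=
  Measure_isProbability.Build _ _ _ part_measure part_measureT.

End positive_part.

Arguments part {d T R m D} mD D0.
Arguments part_measure {d T R m D} mD D0 B.

(* Main.v *)
From HB Require Import structures.
Require Import Defs.
From mathcomp Require Import all_boot all_order all_algebra.
From mathcomp Require Import all_classical all_reals all_analysis.
From mathcomp Require Import lra.

Set Implicit Arguments.
Unset Strict Implicit.
Unset Printing Implicit Defensive.

Import Order.TTheory GRing.Theory Num.Theory.
Import numFieldNormedType.Exports.

Local Open Scope classical_set_scope.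
Local Open Scope ring_scope.

(** Everything is read off absolutely continuous stationary probabilities: by
    Radon-Nikodym an annealed operator has an invariant density if and only if
    there is a probability nu << m such that nu A is the mean of
    nu (g1^-1 A) and nu (g2^-1 A) for all measurable A
    ([has_invariant_densityP]). Such probabilities move between spaces as image
    measures. The image of one for the dynamics on X+ under the inclusion into X
    is one for f1, f2 ([stationary_extend]), whence (S). Conversely, one for
    f1, f2 which does not charge X+ yields one for the dynamics on X-, by a
    retraction of X onto X- ([stationary_restrict]). It remains to see that
    (WAP) would produce a stationary probability which does not charge X+.

    Let P be the annealed operator and phi the uniform density on X-. A Banach
    limit L gives the finitely additive set function
    nu A = L (n |-> \int_A P^n phi), which is stationary by shift invariance of
    L, vanishes on null sets, and gives invariant sets such as X+ the mass of
    phi ([stationary_limit]). It is sigma-additive because weak precompactness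
    of the orbit makes \int_(F k) P^n phi small uniformly in n when the F k
    decrease to the empty set. This is Dini's theorem for the weakly continuous
    functions f |-> \int_(F k) f ([weakly_precompact_unif]). *)

(** * Building measures from set functions *)

Section tools.
Context d (T : measurableType d) (R : realType).

Lemma Rintegral_cvg0 (mu : {measure set T -> \bar R}) (f : T -> R)
    (F : (set T)^nat) :
  mu.-integrable setT (EFin \o f) -> (forall n, measurable (F n)) ->
  (forall i j, (i <= j)%N -> F j `<=` F i) -> \bigcap_n F n = set0 ->
  \int[mu]_(x in F n) f x @[n --> \oo] --> (0 : R).
Proof.
move=> intf mF decF F0; have /integrableP[mf _] := intf.
suff : (\int[mu]_(x in F n) (f x)%:E @[n --> \oo] --> (0 : R)%:E)%E.
  by move=> /fine_cvg.
rewrite [X in X @ _ --> _](_ : _ = fun n =>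
    (\int[mu]_x ((EFin \o f) \_ (F n)) x)%E); last first.
  by apply/funext => n; rewrite integral_mkcond.
rewrite -[0%:E](integral0 mu setT).
apply: (@dominated_cvg _ _ _ mu _ measurableT
  (fun n => (EFin \o f) \_ (F n)) _ (abse \o (EFin \o f))) => //.
- move=> n; apply: (@measurable_int _ _ _ mu).
  by apply/(integrable_mkcond _ (mF n)); exact: integrableS intf.
- move=> x _; have [k NFx] : exists k, ~ F k x.
    apply: contrapT => /forallNP Fx.
    suff : (\bigcap_n F n) x by rewrite F0.
    by move=> n _; apply: contrapT; exact: Fx.
  apply: cvg_near_cst; exists k => // n /= kn.
  by rewrite patchE memNset// => /(decF _ _ kn).
- exact: integrable_abse.
- by move=> n x _; rewrite /= patchE; case: ifP => //=; rewrite normr0 lee_fin.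
Qed.

(** A finitely additive set function is sigma-additive as soon as it is
    continuous at the empty set: the error made by the first n terms of a
    disjoint union is the value on the union of the others. *)
Lemma probability_of_additive (nu0 : set T -> R) :
  (forall A, measurable A -> 0 <= nu0 A) ->
  (forall A B, measurable A -> measurable B -> A `&` B = set0 ->
     nu0 (A `|` B) = nu0 A + nu0 B) ->
  nu0 setT = 1 ->
  (forall F : (set T)^nat, (forall n, measurable (F n)) ->
     (forall i j, (i <= j)%N -> F j `<=` F i) -> \bigcap_n F n = set0 ->
     nu0 (F n) @[n --> \oo] --> (0 : R)) ->
  exists nu : probability T R, forall A, measurable A -> nu A = (nu0 A)%:E.
Proof.
move=> nu_ge0 nuU nuT nu_cvg0.
(* A measure must be nonnegative on all sets, also nonmeasurable ones. *)
pose nu A := (`|nu0 A|)%:E.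
have nuE A : measurable A -> nu A = (nu0 A)%:E.
  by move=> mA; rewrite /nu ger0_norm// nu_ge0.
have nu00 : nu0 set0 = 0.
  by have := nuU _ _ measurable0 measurable0 (setI0 _); rewrite setU0; lra.
have nu0' : nu set0 = 0%E by rewrite nuE// nu00.
have nu_ge0' A : (0 <= nu A)%E by rewrite lee_fin.
have nu_sadd : semi_sigma_additive nu.
  move=> F mF tF mUF.
  have disjF i j x : (i < j)%N -> F i x -> F j x -> False.
    move=> ij Fix Fjx; have : (F i `&` F j) x by [].
    by move/trivIsetP : tF => ->//; rewrite neq_ltn ij.
  pose G n := \bigcup_(i in [set i | (n <= i)%N]) F i.
  have mG n : measurable (G n) by exact: bigcup_measurable.
  have GS n : G n = F n `|` G n.+1.
    apply/seteqP; split=> [x [i /= ni Fix]|x [Fnx|[i /= ni Fix]]].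
    - move: ni; rewrite leq_eqVlt => /orP[/eqP ni|ni].
        by left; rewrite ni.
      by right; exists i.
    - by exists n => /=.
    - by exists i => //=; exact: ltnW.
  have FG n : F n `&` G n.+1 = set0.
    by apply/seteqP; split=> // x [Fnx [i /= /disjF]]; exact.
  have sumE n : nu0 (\bigcup_i F i) = \sum_(0 <= i < n) nu0 (F i) + nu0 (G n).
    elim: n => [|n IH].
      rewrite big_geq// add0r; congr nu0.
      by apply/seteqP; split=> [x [i _ Fi]|x [i _ Fi]]; exists i.
    by rewrite IH big_nat_recr//= GS nuU// addrA.
  rewrite nuE// (_ : (fun n => _) =
    EFin \o (fun n => nu0 (\bigcup_i F i) - nu0 (G n))).
    apply: cvg_EFin; first exact: nearW.
    rewrite -[X in _ --> X]subr0; apply: cvgB; first exact: cvg_cst.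
    apply: nu_cvg0 => //.
    - move=> i j ij x [k /= jk Fkx]; exists k => //=; exact: leq_trans jk.
    - apply/seteqP; split=> // x Gx; have [i _ Fix] := Gx 0%N Logic.I.
      by have [j /= /disjF] := Gx i.+1 Logic.I; exact.
  apply/funext => n /=; rewrite (sumE n) addrK -sumEFin.
  by apply: eq_bigr => i _; exact: nuE.
have nuT' : nu setT = 1%E by rewrite nuE// nuT.
pose nu1 : {measure set T -> \bar R} :=
  HB.pack nu (isMeasure.Build _ _ _ nu nu0' nu_ge0' nu_sadd).
pose nu2 : probability T R :=
  HB.pack (Measure.sort nu1) (Measure.class nu1)
    (Measure_isProbability.Build _ _ _ nu1 nuT').
by exists nu2.
Qed.

End tools.

Lemma pushforward_probability d d' (T : measurableType d)
    (T' : measurableType d') (R : realType) (r : T -> T')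
    (nu : probability T R) :
  measurable_fun setT r ->
  exists nu' : probability T' R, forall A, nu' A = nu (r @^-1` A).
Proof.
move=> mr.
have [nu1 nu1E] : exists nu1 : {measure set T' -> \bar R},
    nu1 = pushforward nu r :> (_ -> _).
  by unshelve eexists (pushforward nu r).
have : nu1 setT = 1%E.
  by rewrite nu1E /pushforward preimage_setT probability_setT.
case: nu1 nu1E => nu1 c /= nu1E nu1T.
pose nu2 : probability T' R :=
  HB.pack nu1 c (Measure_isProbability.Build _ _ _ (Measure.Pack c) nu1T).
by exists nu2 => A; rewrite /nu2/= nu1E.
Qed.

(** * Banach limits *)

(** Bounded functions converge along an ultrafilter: a cluster point, which
    exists by compactness, is the limit because every neighbourhood or its
    complement is charged. *)
Lemma ultra_cvg_bounded (R : realType) (T : Type) (U : set_system T)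
    (u : T -> R) (M : R) : UltraFilter U -> (forall t, `|u t| <= M) ->
  exists l : R, u t @[t --> U] --> l.
Proof.
move=> UU uM; have PU : ProperFilter U := @ultra_proper _ _ UU.
have [|l [_ lu]] := @segment_compact R (- M) M (fmap u U) _.
  by apply: (@filterE _ U) => t; rewrite /= in_itv/= -ler_norml.
exists l => V Vl; have [//|UV] := in_ultra_setVsetC (u @^-1` V) UU.
have UV' : fmap u U (~` V) by [].
by have [t []] := lu _ _ UV' Vl.
Qed.

(** A Banach limit, obtained as the limit of arithmetic means along a free
    ultrafilter: the means of a sequence and of its shift differ by a
    telescoping sum divided by the number of terms, which tends to 0. *)
Lemma banach_limit (R : realType) :
  exists L : (nat -> R) -> R, [/\
    forall u a b, (forall n, a <= u n <= b) -> a <= L u <= b,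
    forall u v M, (forall n, `|u n| <= M) -> (forall n, `|v n| <= M) ->
      L (fun n => u n + v n) = L u + L v,
    forall c u M, (forall n, `|u n| <= M) -> L (fun n => c * u n) = c * L u &
    forall u M, (forall n, `|u n| <= M) -> L (fun n => u n.+1) = L u].
Proof.
have [U [UU ooU]] := ultraFilterLemma (@eventually_filter).
have PU : ProperFilter U := @ultra_proper _ _ UU.
pose mean (u : nat -> R) n := n.+1%:R^-1 * \sum_(0 <= k < n.+1) u k.
pose L u := lim (mean u n @[n --> U]).
have mean_itv u a b n : (forall n, a <= u n <= b) -> a <= mean u n <= b.
  move=> uab; rewrite /mean ler_pdivlMl ?ler_pdivrMl ?ltr0n//.
  have cstE (c : R) : n.+1%:R * c = \sum_(0 <= k < n.+1) c.
    by rewrite sumr_const_nat subn0 mulr_natl.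
  rewrite !cstE; apply/andP; split;
    by apply: ler_sum => k _; case/andP: (uab k).
have mean_bd u (M : R) n : (forall n, `|u n| <= M) -> `|mean u n| <= M.
  by move=> uM; rewrite ler_norml; apply: mean_itv => k; rewrite -ler_norml.
have mean_cvg u (M : R) : (forall n, `|u n| <= M) ->
    mean u n @[n --> U] --> L u.
  move=> uM; have [|l ul] := @ultra_cvg_bounded R _ U (mean u) M UU.
    by move=> n; exact: mean_bd.
  by rewrite /L (cvg_lim _ ul)//.
exists L; split.
- move=> u a b uab.
  have uM n : `|u n| <= `|a| + `|b|.
    have /andP[au ub] := uab n; have := normr_ge0 a; have := normr_ge0 b.
    have := ler_norm (- a); have := ler_norm b; rewrite normrN ler_norml; lra.
  have uL : cvg (mean u n @[n --> U]).
    by apply/cvg_ex; exists (L u); exact: mean_cvg uM.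
  have mab n := mean_itv _ _ _ n uab.
  apply/andP; split; [apply: limr_ge => //|apply: limr_le => //];
    by apply: filterE => n; case/andP: (mab n).
- move=> u v M uM vM; apply: cvg_lim => //.
  rewrite (_ : mean _ = mean u \+ mean v).
    by apply: cvgD; exact: mean_cvg.
  by apply/funext => n; rewrite /mean/= big_split mulrDr.
- move=> c u M uM; apply: cvg_lim => //.
  rewrite (_ : mean _ = fun n => c * mean u n).
    by apply: cvgMr; exact: mean_cvg uM.
  by apply/funext => n; rewrite /mean/= -mulr_sumr mulrCA.
- move=> u M uM; apply: cvg_lim => //.
  rewrite (_ : mean _ =
    fun n => mean u n + n.+1%:R^-1 * (u n.+1 - u 0)); last first.
    apply/funext => n; rewrite /mean -mulrDr; congr (_ * _).
    have : \sum_(0 <= k < n.+2) u k = u 0 + \sum_(0 <= k < n.+1) u k.+1.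
      exact: big_nat_recl.
    by rewrite big_nat_recr//= => E; lra.
  rewrite -[L u]addr0; apply: cvgD; first exact: mean_cvg uM.
  have : n.+1%:R^-1 * (u n.+1 - u 0) @[n --> \oo] --> (0 : R).
    apply/norm_cvg0P.
    apply: (@squeeze_cvgr _ _ _ _ (cst 0) (fun n => n.+1%:R^-1 * (M + M))).
    - apply: nearW => n; rewrite normr_ge0/= normrM ger0_norm ?invr_ge0//.
      by rewrite ler_wpM2l ?invr_ge0// (le_trans (ler_normB _ _))// lerD.
    - exact: cvg_cst.
    - by rewrite -(mul0r (M + M)); apply: cvgMl; exact: cvg_harmonic.
  exact: cvg_trans (cvg_app _ ooU).
Qed.

(** * Invariant densities and stationary measures *)

Section stationary.
Context d (T : measurableType d) (R : realType) (mu : probability T R).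

Lemma L1_integrable (f : L1 mu) : mu.-integrable setT (EFin \o f).
Proof. by apply/Lfun1_integrable; exact: LfunP. Qed.

Lemma L1_integrable_on (f : L1 mu) A :
  measurable A -> mu.-integrable A (EFin \o f).
Proof. by move=> mA; apply: integrableS (L1_integrable f). Qed.

Lemma Rintegral_EFin (f : L1 mu) A : measurable A ->
  (\int[mu]_(x in A) (f x)%:E)%E = (\int[mu]_(x in A) f x)%:E.
Proof.
move=> mA; rewrite fineK//; apply: integrable_fin_num => //.
exact: L1_integrable_on.
Qed.

Lemma nonsingular_preimage (g : T -> T) A :
  nonsingular mu g -> measurable A -> measurable (g @^-1` A).
Proof. by move=> [mg _] mA; rewrite -[X in measurable X]setTI; exact: mg. Qed.

Variables g1 g2 : T -> T.
Hypotheses (ns1 : nonsingular mu g1) (ns2 : nonsingular mu g2).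

Lemma Rintegral_annealed (f : L1 mu) A : measurable A ->
  \int[mu]_(x in A) annealed_pf mu g1 g2 f x =
  2^-1 * (\int[mu]_(x in g1 @^-1` A) f x + \int[mu]_(x in g2 @^-1` A) f x).
Proof.
move=> mA.
have pfE g : nonsingular mu g -> \int[mu]_(x in A) perron_frobenius mu g f x =
    \int[mu]_(x in g @^-1` A) f x.
  by move=> nsg; rewrite /Rintegral (perron_frobeniusP f nsg mA).
rewrite -!pfE// mulrDr -!RintegralZl//; [|exact: L1_integrable_on..].
have scaled g : mu.-integrable A
    (EFin \o (fun x => 2^-1 * perron_frobenius mu g f x)).
  apply: (@integrableZl _ _ _ mu _ mA 2^-1 (EFin \o perron_frobenius mu g f)).
  exact: L1_integrable_on.
by rewrite -RintegralD.
Qed.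

Definition stationary (nu : set T -> \bar R) := forall A, measurable A ->
  nu A = (2^-1%:E * (nu (g1 @^-1` A) + nu (g2 @^-1` A)))%E.

(** Testing against the indicators of measurable sets turns the equation
    P h = h into stationarity of the measure with density h; Radon-Nikodym
    gives the way back. Measures rather than densities are used below because
    they have images under maps. *)
Lemma has_invariant_densityP :
  has_invariant_density (annealed_pf mu g1 g2) <->
  exists nu : probability T R, nu `<< mu /\ stationary nu.
Proof.
split=> [[h [h0 h1 Ph]]|[nu [numu nuS]]].
  have hE A : measurable A -> \int[mu]_(x in A) annealed_pf mu g1 g2 h x =
      \int[mu]_(x in A) h x.
    move=> mA; congr fine; apply: ae_eq_integral => //.
    - exact: measurable_int (L1_integrable_on _ mA).
    - exact: measurable_int (L1_integrable_on _ mA).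
    - by apply: filterS Ph => x /= /(_ Logic.I) ->.
  have h_ge0 A : measurable A -> 0 <= \int[mu]_(x in A) h x.
    move=> mA; apply: fine_ge0.
    rewrite (_ : (\int[mu]_(x in A) (h x)%:E = \int[mu]_(x in A) `|h x|%:E)%E).
      exact: integral_ge0.
    apply: ae_eq_integral => //.
    - exact: measurable_int (L1_integrable_on _ mA).
    - exact: measurable_int (integrable_abse (L1_integrable_on h mA)).
    - by apply: filterS h0 => x /= hx _; rewrite ger0_norm.
  have [] := @probability_of_additive _ T R
    (fun A => \int[mu]_(x in A) h x) h_ge0.
  - move=> A B mA mB AB; rewrite Rintegral_setU//.
      by apply: L1_integrable_on; exact: measurableU.
    by apply/disj_setPS; rewrite AB.
  - by rewrite /Rintegral h1.
  - by move=> F mF decF F0; apply: Rintegral_cvg0 => //; exact: L1_integrable.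
  move=> nu nuE; exists nu; split.
    apply/null_content_dominatesP => A mA muA.
    rewrite nuE// -Rintegral_EFin//; apply: null_set_integral => //.
    exact: measurable_int (L1_integrable_on _ mA).
  move=> A mA; rewrite !nuE//; [|exact: nonsingular_preimage..].
  by rewrite -hE// Rintegral_annealed// EFinM EFinD.
pose h0 := Radon_Nikodym_SigmaFinite.f nu mu.
have h0_ge0 x : (0 <= h0 x)%E by exact: Radon_Nikodym_SigmaFinite.f_ge0.
have h0E : EFin \o (fine \o h0) = h0.
  apply/funext => x /=; rewrite fineK//.
  exact: Radon_Nikodym_SigmaFinite.f_fin_num.
have Lh : fine \o h0 \in Lfun mu 1.
  apply/Lfun1_integrable; rewrite h0E.
  exact: Radon_Nikodym_SigmaFinite.f_integrable.
pose h : L1 mu := Lfun_Sub (lexx 1%E) Lh.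
have hE A : measurable A -> (\int[mu]_(x in A) (h x)%:E)%E = nu A.
  move=> mA; rewrite (Radon_Nikodym_SigmaFinite.f_integral numu mA) -/h0.
  by rewrite -[in RHS]h0E.
exists h; split.
- by apply: aeW => x; exact: fine_ge0.
- by rewrite hE// probability_setT.
- have : ae_eq mu setT (EFin \o annealed_pf mu g1 g2 h) (EFin \o h).
    apply: integral_ae_eq => //; first exact: L1_integrable.
      exact: measurable_int (L1_integrable _).
    move=> A _ mA; transitivity (\int[mu]_(x in A) annealed_pf mu g1 g2 h x)%:E.
      exact: Rintegral_EFin.
    transitivity (nu A); last by rewrite -hE.
    rewrite Rintegral_annealed// nuS// EFinM EFinD -!Rintegral_EFin ?hE//;
      exact: nonsingular_preimage.
  by apply: filterS => x /= /(_ Logic.I) [].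
Qed.

End stationary.

(** * Weak precompactness and uniform integrability *)

Section weak_compactness.
Context d (T : measurableType d) (R : realType) (mu : probability T R).

Lemma weak_continuous_Rintegral A : measurable A ->
  continuous ((fun f : L1 mu => \int[mu]_(x in A) f x) : weakL1 mu -> R).
Proof.
move=> mA; pose l (f : L1 mu) : R^o := \int[mu]_(x in A) f x.
have l_linear : linear l.
  move=> c f g; rewrite /l/= RintegralD//; last exact: L1_integrable_on.
    by rewrite RintegralZl//; exact: L1_integrable_on.
  apply: (@integrableZl _ _ _ mu _ mA c (EFin \o f)).
  exact: L1_integrable_on.
pose L : {linear L1 mu -> R^o} :=
  HB.pack l (GRing.isLinear.Build _ _ _ _ l l_linear).
have LB : bounded_functional mu L.
  exists 1 => f; rewrite mul1e Lnorm1.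
  apply: (@le_trans _ _ (\int[mu]_(x in A) `|(EFin \o f) x|)%E).
    rewrite /= -abse_EFin -Rintegral_EFin//; apply: le_abse_integral => //.
    exact: measurable_int (L1_integrable_on _ mA).
  apply: ge0_subset_integral => //.
  exact: measurable_int (integrable_abse (L1_integrable f)).
pose i : bounded_functional mu := exist _ L (mem_set LB).
move=> f.
have evC : {for f, continuous (@dual_eval _ _ _ mu : weakL1 mu -> _)}.
  exact: initial_continuous.
exact: (continuous_comp evC (@proj_continuous _ _ i (dual_eval f))).
Qed.

(** Dini's argument. Otherwise there are functions u n in S with integral
    more than e on F n. For n >= k, since u n is nonnegative and F n is
    contained in F k, the integral of u n over F k is also more than e. Hence a
    weak cluster point of the u n has integral at least e on every F k, which is
    absurd as these integrals tend to 0. *)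
Lemma weakly_precompact_unif (S : set (weakL1 mu)) (F : (set T)^nat) (e : R) :
  precompact S ->
  (forall f : L1 mu, S f ->
     forall A, measurable A -> 0 <= \int[mu]_(x in A) f x) ->
  (forall n, measurable (F n)) -> (forall i j, (i <= j)%N -> F j `<=` F i) ->
  \bigcap_n F n = set0 -> 0 < e ->
  exists n, forall f : L1 mu, S f -> \int[mu]_(x in F n) f x <= e.
Proof.
rewrite precompactE => cS S0 mF decF F0 e0.
apply: contrapT => /forallNP H.
have {}H n : exists f : weakL1 mu, S f /\ e < \int[mu]_(x in F n) (f : L1 mu) x.
  have /existsNP[f /not_implyP[Sf /negP]] := H n.
  by rewrite -ltNge => ?; exists f.
have /choice[u uP] := H.
have [|f [_ fu]] := cS (fmap u \oo) _.
  by apply: (@filterE _ \oo) => n; apply: subset_closure; case: (uP n).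
have ef k : e <= \int[mu]_(x in F k) (f : L1 mu) x.
  rewrite leNgt; apply/negP => fe.
  pose V := [set g : weakL1 mu | \int[mu]_(x in F k) (g : L1 mu) x < e].
  have Vf : nbhs f V.
    by have := @weak_continuous_Rintegral _ (mF k) f; move/(_ _ (lt_nbhsl fe)).
  have Fu : fmap u \oo (u @` [set n | (k <= n)%N]).
    by exists k => // n /= kn; exists n.
  have [_ [[n kn <-]]] := fu _ _ Fu Vf.
  have [Sun eun] := uP n; apply/negP; rewrite -leNgt (le_trans (ltW eun))//.
  rewrite -(setDUK (decF _ _ kn)) Rintegral_setU//.
  - by rewrite lerDl S0//; exact: measurableD.
  - exact: measurableD.
  - by apply: L1_integrable_on; rewrite setDUK//; exact: decF.
  - by apply/disj_setPS; rewrite setIDA setIC -setIDA setDv setI0.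
have := @Rintegral_cvg0 _ _ _ mu (f : L1 mu) F (L1_integrable f) mF decF F0.
move=> /(cvgr_lt 0)/(_ e e0)[n _ /(_ n (leqnn n))] /=.
by rewrite ltNge ef.
Qed.

End weak_compactness.

(** * Almost periodic orbits have stationary limits *)

Section almost_periodic.
Context d (T : measurableType d) (R : realType) (mu : probability T R).
Variables g1 g2 : T -> T.
Hypotheses (ns1 : nonsingular mu g1) (ns2 : nonsingular mu g2).
Let P := annealed_pf mu g1 g2.

Lemma iter_annealed_ge0 (phi : L1 mu) n :
  (forall A, measurable A -> 0 <= \int[mu]_(x in A) phi x) ->
  forall A, measurable A -> 0 <= \int[mu]_(x in A) iter n P phi x.
Proof.
move=> phi0; elim: n => //= n IH A mA; rewrite Rintegral_annealed//.
by rewrite mulr_ge0// addr_ge0//; apply: IH;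
  [exact: nonsingular_preimage ns1 _|exact: nonsingular_preimage ns2 _].
Qed.

Lemma iter_annealed_invariant (phi : L1 mu) n A : measurable A ->
  g1 @^-1` A = A -> g2 @^-1` A = A ->
  \int[mu]_(x in A) iter n P phi x = \int[mu]_(x in A) phi x.
Proof.
move=> mA g1A g2A; elim: n => //= n IH.
by rewrite Rintegral_annealed// g1A g2A IH; lra.
Qed.

(** The Banach limit of the masses that the measures with densities P^n phi
    give to a set. Additivity and stationarity pass to the limit; almost
    periodicity gives sigma-additivity. *)
Lemma stationary_limit (phi : L1 mu) :
  (forall A, measurable A -> 0 <= \int[mu]_(x in A) phi x) ->
  \int[mu]_x phi x = 1 -> weakly_almost_periodic P ->
  exists nu : probability T R, [/\ nu `<< mu, stationary g1 g2 nu &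
    forall A, measurable A -> g1 @^-1` A = A -> g2 @^-1` A = A ->
      nu A = (\int[mu]_(x in A) phi x)%:E].
Proof.
move=> phi0 phi1 /(_ phi) cP; have [L [L_itv LD LZ LS]] := banach_limit R.
pose a A n := \int[mu]_(x in A) iter n.+1 P phi x.
have a_ge0 A n : measurable A -> 0 <= a A n by exact: iter_annealed_ge0.
have aU A B n : measurable A -> measurable B -> A `&` B = set0 ->
    a (A `|` B) n = a A n + a B n.
  move=> mA mB AB; rewrite /a Rintegral_setU//.
    by apply: L1_integrable_on; exact: measurableU.
  by apply/disj_setPS; rewrite AB.
have aT n : a setT n = 1 by rewrite -phi1; exact: iter_annealed_invariant.
have a01 A n : measurable A -> 0 <= a A n <= 1.
  move=> mA; rewrite a_ge0//= -(aT n) -(setUv A) aU ?setICr//.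
    by rewrite lerDl a_ge0//; exact: measurableC.
  exact: measurableC.
have aM A : measurable A -> forall n, `|a A n| <= 1.
  by move=> mA n; have /andP[? ?] := a01 A n mA; rewrite ger0_norm.
have L_cst u c : (forall n, u n = c) -> L u = c.
  move=> uc; apply/eqP; rewrite eq_le andbC; apply: L_itv => n.
  by rewrite uc lexx.
have aS A n : measurable A ->
    a A n.+1 = 2^-1 * (a (g1 @^-1` A) n + a (g2 @^-1` A) n).
  by move=> mA; exact: Rintegral_annealed.
have [] := @probability_of_additive _ T R (fun A => L (a A)).
- by move=> A mA; have /andP[] := L_itv _ _ _ (fun n => a01 A n mA).
- move=> A B mA mB AB; rewrite -(LD _ _ 1); [|exact: aM..].
  by congr L; apply/funext => n; exact: aU.
- exact: L_cst.
- move=> F mF decF F0; apply/cvgrPdist_le => e e0.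
  have [|N HN] := weakly_precompact_unif cP _ mF decF F0 e0.
    by move=> _ [n _ <-]; exact: iter_annealed_ge0.
  exists N => // n /= Nn; rewrite sub0r normrN.
  have : forall k, 0 <= a (F n) k <= e.
    move=> k; rewrite a_ge0//=.
    have /= := HN (iter k.+1 P phi) (ex_intro2 _ _ k.+1 isT erefl).
    apply: le_trans; rewrite -/(a (F N) k) -(setDUK (decF _ _ Nn)) aU//.
    - by rewrite lerDl a_ge0//; exact: measurableD.
    - exact: measurableD.
    - by rewrite setIDA setIC -setIDA setDv setI0.
  by move=> /L_itv /andP[? ?]; rewrite ger0_norm.
move=> nu nuE; exists nu; split.
- apply/null_content_dominatesP => A mA muA; rewrite nuE// (L_cst _ 0)// => n.
  rewrite /a /Rintegral null_set_integral//.
  exact: measurable_int (L1_integrable_on _ mA).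
- move=> A mA; have m1 := nonsingular_preimage ns1 mA.
  have m2 := nonsingular_preimage ns2 mA.
  rewrite !nuE// -EFinD -EFinM; congr EFin.
  rewrite -(LS _ 1); last exact: aM.
  rewrite -(LD _ _ 1); [|exact: aM..].
  rewrite -(LZ _ _ 2).
    by congr L; apply/funext => n; exact: aS.
  by move=> n; rewrite (le_trans (ler_normD _ _))// -[2]/(1 + 1) lerD// aM.
- by move=> A mA g1A g2A; rewrite nuE//; congr EFin; apply: L_cst => n;
    exact: iter_annealed_invariant.
Qed.

End almost_periodic.

(** * Passing between a space and an invariant part *)

Section part_dynamics.
Context d (T : measurableType d) (R : realType) (m : probability T R).
Variables (D : set T) (mD : measurable D) (D0 : (0 < m D)%E).
Let incl : part mD D0 -> T := @part_incl _ _ _ _ _ mD D0.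

Lemma part_measure_eq0 B :
  part_measure mD D0 B = 0%E <-> m (incl @` B) = 0%E.
Proof.
have mD_neq0 : fine (m D) != 0.
  by rewrite gt_eqF// fine_gt0// D0 ltey_eq fin_num_measure.
rewrite /part_measure; split=> [/eqP|->]; last by rewrite mul0e.
by rewrite mule_eq0 eqe invr_eq0 (negPf mD_neq0) orbF => /eqP.
Qed.

Section conjugacy.
Variables (f : T -> T) (tau : part mD D0 -> part mD D0).
Hypothesis ftau : forall x, f (incl x) = incl (tau x).

Lemma preimage_part A : D `&` f @^-1` A = incl @` (tau @^-1` (incl @^-1` A)).
Proof.
rewrite -(image_part_incl mD D0); congr image.
by apply/funext => x; rewrite /preimage/= ftau.
Qed.

Hypothesis nstau : nonsingular (part_measure mD D0) tau.

Lemma measurable_preimage_part A :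
  measurable A -> measurable (D `&` f @^-1` A).
Proof.
move=> mA; rewrite preimage_part; apply: measurable_image_part.
apply: (nonsingular_preimage nstau).
by rewrite -[X in measurable X]setTI; exact: measurable_part_incl.
Qed.

Lemma null_preimage_part A :
  measurable A -> m A = 0%E -> m (D `&` f @^-1` A) = 0%E.
Proof.
move=> mA mA0; rewrite preimage_part; apply/part_measure_eq0; apply: nstau.2.
  by rewrite -[X in measurable X]setTI; exact: measurable_part_incl.
apply/part_measure_eq0; rewrite image_part_incl.
by apply: subset_measure0 mA0 => //; exact: measurableI.
Qed.

End conjugacy.

Variables (f1 f2 : T -> T) (tau1 tau2 : part mD D0 -> part mD D0).
Hypotheses (f1tau : forall x, f1 (incl x) = incl (tau1 x))
  (f2tau : forall x, f2 (incl x) = incl (tau2 x)).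

Lemma stationary_extend (nu : probability (part mD D0) R) :
  nu `<< part_measure mD D0 -> stationary tau1 tau2 nu ->
  exists nu' : probability T R, nu' `<< m /\ stationary f1 f2 nu'.
Proof.
move=> /null_content_dominatesP nuac nuS.
have [nu' nu'E] :=
  pushforward_probability nu (@measurable_part_incl _ _ _ _ _ mD D0).
have mincl A : measurable A -> measurable (incl @^-1` A).
  by move=> mA; rewrite -[X in measurable X]setTI; exact: measurable_part_incl.
exists nu'; split.
  apply/null_content_dominatesP => A mA mA0; rewrite nu'E.
  apply: nuac; first exact: mincl.
  apply/part_measure_eq0; rewrite image_part_incl.
  by apply: subset_measure0 mA0 => //; exact: measurableI.
move=> A mA; rewrite !nu'E nuS; last exact: mincl.
have E f tau : (forall x, f (incl x) = incl (tau x)) ->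
    tau @^-1` (incl @^-1` A) = incl @^-1` (f @^-1` A).
  by move=> ftau; apply/funext => x; rewrite /preimage/= ftau.
by rewrite (E f1)// (E f2).
Qed.

(** A left inverse of the inclusion; for a measure that does not charge the
    complement of D it is an inverse up to null sets, and so it carries that
    measure to the part. *)
Definition part_retract (x : T) : part mD D0 :=
  if pselect (D x) is left Dx then exist _ x (mem_set Dx) else part_point mD D0.

Lemma part_retractK : cancel incl part_retract.
Proof.
move=> x; apply: part_incl_inj; rewrite /part_retract.
by case: pselect => // -[]; exact: part_inclP.
Qed.

Lemma part_retract_preimage B : D `&` part_retract @^-1` B = incl @` B.
Proof.
rewrite -(image_part_incl mD D0); congr image.
by apply/funext => x; rewrite /preimage/= part_retractK.
Qed.

Lemma measurable_part_retract : measurable_fun setT part_retract.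
Proof.
move=> _ B mB; rewrite setTI -[X in measurable X]setIT -(setUv D) setIUr.
apply: measurableU; rewrite setIC.
  by rewrite part_retract_preimage; exact: measurable_image_part.
have rE : {in ~` D, part_retract =1 cst (part_point mD D0)}.
  by move=> x; rewrite inE /part_retract /=; case: pselect.
case: (pselect (B (part_point mD D0))) => [Bp|nBp].
  rewrite (_ : _ `&` _ = ~` D); first exact: measurableC.
  apply/seteqP; split=> [x []//|x nDx]; split=> //.
  by rewrite /preimage/= rE// inE.
rewrite (_ : _ `&` _ = set0)//; apply/seteqP; split=> // x [nDx].
by rewrite /preimage/= rE// inE.
Qed.

Lemma stationary_restrict (nu : probability T R) :
  measurable_fun setT tau1 -> measurable_fun setT tau2 ->
  measurable_fun setT f1 -> measurable_fun setT f2 ->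
  nu `<< m -> stationary f1 f2 nu -> nu (~` D) = 0%E ->
  exists nu' : probability (part mD D0) R,
    nu' `<< part_measure mD D0 /\ stationary tau1 tau2 nu'.
Proof.
move=> mt1 mt2 mf1 mf2 /null_content_dominatesP nuac nuS nuD.
have [nu' nu'E] := pushforward_probability nu measurable_part_retract.
have mr B : measurable B -> measurable (part_retract @^-1` B).
  move=> mB; rewrite -[X in measurable X]setTI.
  exact: measurable_part_retract.
have nuI A : measurable A -> nu A = nu (D `&` A).
  move=> mA; rewrite (measureDI nu mA mD) setIC.
  rewrite [X in (X + _)%E](_ : _ = 0%E) ?add0e//.
  apply: subset_measure0 nuD; [exact: measurableD|exact: measurableC|].
  by move=> x [].
exists nu'; split.
  apply/null_content_dominatesP => B mB /part_measure_eq0 mB0.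
  rewrite nu'E nuI; last exact: mr.
  rewrite part_retract_preimage; apply: nuac => //.
  exact: measurable_image_part.
move=> B mB; rewrite !nu'E nuS; last exact: mr.
have E f tau : measurable_fun setT f -> measurable_fun setT tau ->
    (forall x, f (incl x) = incl (tau x)) ->
    nu (f @^-1` (part_retract @^-1` B)) = nu (part_retract @^-1` (tau @^-1` B)).
  move=> mf mtau ftau; rewrite nuI; last first.
    by rewrite -[X in measurable X]setTI; apply: mf => //; exact: mr.
  rewrite [RHS]nuI; last first.
    by apply: mr; rewrite -[X in measurable X]setTI; exact: mtau.
  rewrite part_retract_preimage (preimage_part ftau); congr (nu (incl @` _)).
  by apply/funext => x; rewrite /preimage/= part_retractK.
by rewrite (E f1 tau1)// (E f2 tau2).
Qed.

End part_dynamics.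

(** * Gluing the dynamics of two parts *)

Lemma glued_nonsingular d (T : measurableType d) (R : realType)
    (m : probability T R) (A B : set T) (mA : measurable A) (mB : measurable B)
    (A0 : (0 < m A)%E) (B0 : (0 < m B)%E)
    (f : T -> T) (tauA : part mA A0 -> part mA A0)
    (tauB : part mB B0 -> part mB B0) :
  A `|` B = setT ->
  nonsingular (part_measure mA A0) tauA ->
  nonsingular (part_measure mB B0) tauB ->
  (forall x : part mA A0, f (part_incl x) = part_incl (tauA x)) ->
  (forall x : part mB B0, f (part_incl x) = part_incl (tauB x)) ->
  nonsingular m f.
Proof.
move=> AB nsA nsB fA fB.
have fE C : f @^-1` C = (A `&` f @^-1` C) `|` (B `&` f @^-1` C).
  by rewrite -setIUl AB setTI.
split=> [_ C mC|C mC mC0]; rewrite ?setTI fE.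
  by apply: measurableU; [exact: measurable_preimage_part fA nsA _ mC|
    exact: measurable_preimage_part fB nsB _ mC].
apply: null_set_setU.
- exact: measurable_preimage_part fA nsA _ mC.
- exact: measurable_preimage_part fB nsB _ mC.
- exact: null_preimage_part fA nsA _ mC mC0.
- exact: null_preimage_part fB nsB _ mC mC0.
Qed.

Lemma invariant_part d (T : measurableType d) (R : realType)
    (m : probability T R) (A B : set T) (mA : measurable A) (mB : measurable B)
    (A0 : (0 < m A)%E) (B0 : (0 < m B)%E)
    (f : T -> T) (tauA : part mA A0 -> part mA A0)
    (tauB : part mB B0 -> part mB B0) :
  A `&` B = set0 -> A `|` B = setT ->
  (forall x : part mA A0, f (part_incl x) = part_incl (tauA x)) ->
  (forall x : part mB B0, f (part_incl x) = part_incl (tauB x)) ->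
  f @^-1` B = B.
Proof.
move=> AB0 AB fA fB; have fD (D : set T) (mD : measurable D)
    (D0 : (0 < m D)%E) (tau : part mD D0 -> part mD D0) :
    (forall x : part mD D0, f (part_incl x) = part_incl (tau x)) ->
    forall x, D x -> D (f x).
  move=> ftau x Dx; have := ftau (exist _ x (mem_set Dx)).
  by rewrite /part_incl/= => ->; exact: part_inclP.
apply/seteqP; split=> x; last exact: fD fB x.
have : (A `|` B) x by rewrite AB.
case=> // /(fD _ _ _ _ fA) Afx Bfx.
by have : (A `&` B) (f x) by []; rewrite AB0.
Qed.

Lemma uniform_density d (T : measurableType d) (R : realType)
    (m : probability T R) (D : set T) : measurable D -> (0 < m D)%E ->
  exists phi : L1 m, forall A, measurable A ->
    \int[m]_(x in A) phi x = (fine (m D))^-1 * fine (m (D `&` A)).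
Proof.
move=> mD D0; have LD : (\1_D : T -> R) \in Lfun m 1.
  by apply/Lfun1_integrable; exact: integrable_indic.
exists ((fine (m D))^-1 *: (Lfun_Sub (lexx 1%E) LD : L1 m)) => A mA.
rewrite RintegralZl//; last exact: (L1_integrable_on (Lfun_Sub (lexx 1%E) LD)).
by congr (_ * fine _); rewrite /= integral_indic.
Qed.

Theorem proposition1p22 (R : realType) (X : ptopologicalType)
    (polishX : polish_space R X) (m : probability (borel X) R)
    (Xm Xp : set (borel X)) (mXm : measurable Xm) (mXp : measurable Xp)
    (disjX : Xm `&` Xp = set0) (coverX : Xm `|` Xp = setT)
    (Xm_gt0 : (0 < m Xm)%E) (Xp_gt0 : (0 < m Xp)%E)
    (tau1m tau2m : part mXm Xm_gt0 -> part mXm Xm_gt0)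
    (tau1p tau2p : part mXp Xp_gt0 -> part mXp Xp_gt0)
    (ns_tau1m : nonsingular (part_measure mXm Xm_gt0) tau1m)
    (ns_tau2m : nonsingular (part_measure mXm Xm_gt0) tau2m)
    (ns_tau1p : nonsingular (part_measure mXp Xp_gt0) tau1p)
    (ns_tau2p : nonsingular (part_measure mXp Xp_gt0) tau2p)
    (f1 f2 : borel X -> borel X)
    (f1m : forall x : part mXm Xm_gt0, f1 (part_incl x) = part_incl (tau1m x))
    (f1p : forall x : part mXp Xp_gt0, f1 (part_incl x) = part_incl (tau1p x))
    (f2m : forall x : part mXm Xm_gt0, f2 (part_incl x) = part_incl (tau2m x))
    (f2p : forall x : part mXp Xp_gt0, f2 (part_incl x) = part_incl (tau2p x))
    (S_plus :
      has_invariant_density (annealed_pf (part_measure mXp Xp_gt0) tau1p tau2p))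
    (not_S_minus :
      ~ has_invariant_density
          (annealed_pf (part_measure mXm Xm_gt0) tau1m tau2m)) :
  has_invariant_density (annealed_pf m f1 f2) /\
  ~ weakly_almost_periodic (annealed_pf m f1 f2).
Proof.
have ns1 : nonsingular m f1.
  exact: glued_nonsingular coverX ns_tau1m ns_tau1p f1m f1p.
have ns2 : nonsingular m f2.
  exact: glued_nonsingular coverX ns_tau2m ns_tau2p f2m f2p.
split.
  apply/has_invariant_densityP => //.
  move/(has_invariant_densityP ns_tau1p ns_tau2p) : S_plus => [nu [nuac nuS]].
  exact (stationary_extend f1p f2p nuac nuS).
move=> wap; apply: not_S_minus; apply/has_invariant_densityP => //.
have [phi phiE] := uniform_density mXm Xm_gt0.
have [| |nu [nuac nuS nuI]] := stationary_limit ns1 ns2 _ _ wap (phi := phi).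
- by move=> A mA; rewrite phiE// mulr_ge0// ?invr_ge0 fine_ge0.
- rewrite phiE// setIT mulVf// gt_eqF// fine_gt0// Xm_gt0 ltey_eq.
  by rewrite fin_num_measure.
apply: (stationary_restrict f1m f2m _ _ _ _ nuac nuS) => //;
  [exact: ns_tau1m.1|exact: ns_tau2m.1|exact: ns1.1|exact: ns2.1|].
have -> : ~` Xm = Xp.
  apply/seteqP; split=> x; last first.
    by move=> Xpx Xmx; have : (Xm `&` Xp) x by []; rewrite disjX.
  have : (Xm `|` Xp) x by rewrite coverX.
  by case=> [Xmx /(_ Xmx)|].
(* Xp is invariant and phi has no mass there, so nu does not charge it. *)
rewrite nuI//.
- by rewrite phiE// disjX measure0 mulr0.
- exact: invariant_part disjX coverX f1m f1p.
- exact: invariant_part disjX coverX f2m f2p.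
Qed.
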